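(* Let $RegB$ be the variety of regular bands, i.e. the variety of all bands satisfying the identity $zxyz\approx zxzyz$. Then $\dim(RegB)=4$.
   Context: A band is an idempotent semigroup, viewed as an algebra of type $(2)$ (one binary operation, written as juxtaposition). A hypersubstitution of type $(2)$ is a choice $\sigma$ of a binary term $\sigma(xy)$ in the variables $x,y$. For an algebra $\mathbf{A}=(A,\cdot)$ of type $(2)$ the derived algebra $\mathbf{A}_{\sigma}$ is the set $A$ with the binary term operation induced by $\sigma(xy)$ on $\mathbf{A}$. For a variety $V$ of type $(2)$, the derived variety $V_{\sigma}$ is the variety (of type $(2)$) generated by $\{\mathbf{A}_{\sigma}:\mathbf{A}\in V\}$; it is proper if $V_{\sigma}\neq V$. The dimension $\dim(V)$ is the cardinality of the set of all proper derived varieties $V_{\sigma}$ of $V$ that are included in $V$, where $\sigma$ ranges over all hypersubstitutions of type $(2)$. *)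

(* Defs.v *)
From mathcomp Require Import all_boot.
From mathcomp Require Import boolp classical_sets functions cardinality.

Set Implicit Arguments.
Unset Strict Implicit.
Unset Printing Implicit Defensive.

Local Open Scope classical_set_scope.

(* Algebras of type (2).  MathComp's magmaType cannot be used here: the
   universe of its carriers lies above that of the argument of set, so that
   set magmaType is a universe inconsistency. *)
Record algebra : Type := Algebra {
  carrier :> Type;
  op : carrier -> carrier -> carrier
}.

Declare Scope algebra_scope.
Local Open Scope algebra_scope.
Notation "x ** y" := (op x y) (at level 40, left associativity) : algebra_scope.

Inductive term (X : Type) : Type :=
  | Var of X
  | App of term X & term X.

Fixpoint eval (X : Type) (A : algebra) (v : X -> A) (t : term X) : A :=
  match t with
  | Var x => v x
  | App t1 t2 => eval v t1 ** eval v t2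
  end.

Definition identity : Type := (term nat * term nat)%type.

Definition satisfies (A : algebra) (e : identity) : Prop :=
  forall v : nat -> A, eval v e.1 = eval v e.2.

Definition models (E : set identity) : set algebra :=
  [set A | forall e, E e -> satisfies A e].

Definition is_variety (V : set algebra) : Prop :=
  exists E : set identity, V = models E.

Definition generated_variety (K : set algebra) : set algebra :=
  \bigcap_(W in [set W | is_variety W /\ K `<=` W]) W.

(* The binary term sigma(xy), with false standing for the variable x and true
   for the variable y. *)
Definition hypersubstitution : Type := term bool.

Definition derived (s : hypersubstitution) (A : algebra) : algebra :=
  Algebra (fun x y : A => eval (fun b : bool => if b then y else x) s).

Definition derived_variety (V : set algebra) (s : hypersubstitution) :
    set algebra :=
  generated_variety [set derived s A | A in V].

Definition proper_derived_subvarieties (V : set algebra) :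
    set (set algebra) :=
  [set W | (exists s, W = derived_variety V s) /\ W <> V /\ W `<=` V].

Definition has_dim (V : set algebra) (n : nat) : Prop :=
  (proper_derived_subvarieties V #= `I_n)%card.

Definition is_band (A : algebra) : Prop :=
  associative (@op A) /\ forall x : A, x ** x = x.

Definition RegB : set algebra :=
  [set A | is_band A /\
           forall x y z : A, z ** x ** y ** z = z ** x ** z ** y ** z].

(* Main.v *)
Require Import Defs.
From mathcomp Require Import all_boot.
From mathcomp Require Import boolp classical_sets functions cardinality.

(**
  In every band a binary term takes one of the six values x, y, xy, yx, xyx,
  yxy.  On regular bands the derived operations x and y give exactly the
  left-zero and the right-zero bands, xy and yx give back RegB, and xyx and yxy
  give exactly the left-regular and the right-regular bands.  The two-element
  left-zero band, right-zero band and semilattice separate these five varieties.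
*)

Set Implicit Arguments.
Unset Strict Implicit.
Unset Printing Implicit Defensive.

Local Open Scope classical_set_scope.
Local Open Scope algebra_scope.

(** * Classes of bands defined by identities *)

Lemma is_variety_identity (V : set algebra) (e : identity) :
  (forall A, V A <-> satisfies A e) -> is_variety V.
Proof.
move=> VE; exists [set e]; apply/seteqP; split => A.
  by move=> /VE Ae _ ->.
by move=> EA; apply/VE/EA.
Qed.

Lemma is_varietyI (V W : set algebra) :
  is_variety V -> is_variety W -> is_variety (V `&` W).
Proof.
move=> [E ->] [F ->]; exists (E `|` F); apply/seteqP; split => A.
  by move=> [EA FA] e [/EA|/FA].
by move=> EFA; split=> e ?; apply: EFA; [left | right].
Qed.

Lemma generated_variety_id (V : set algebra) :
  is_variety V -> generated_variety V = V.
Proof.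
move=> varV; apply/seteqP; split => A; last by move=> VA W [_]; apply.
by apply; split.
Qed.

(** Indices from 3 on get the default [x]; it is harmless, as the identities below use only the
    variables 0, 1, 2. *)
Definition valuation3 (T : Type) (x y z : T) : nat -> T :=
  nth x [:: x; y; z].

Notation "''x'" := (Var 0%N) : algebra_scope.
Notation "''y'" := (Var 1%N) : algebra_scope.
Notation "''z'" := (Var 2%N) : algebra_scope.
Notation "s *' t" := (App s t) (at level 40, left associativity) :
  algebra_scope.

Lemma is_variety_band : is_variety is_band.
Proof.
apply: is_varietyI.
  apply: (@is_variety_identity _ ('x *' ('y *' 'z), 'x *' 'y *' 'z)) => A.
  split=> [assocA v | idA x y z]; first exact: assocA.
  exact: idA (valuation3 x y z).
apply: (@is_variety_identity _ ('x *' 'x, 'x)) => A.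
split=> [idemA v | idA x]; first exact: idemA.
exact: idA (valuation3 x x x).
Qed.

Lemma is_variety_RegB : is_variety RegB.
Proof.
apply: is_varietyI is_variety_band _.
apply: (@is_variety_identity _
  ('z *' 'x *' 'y *' 'z, 'z *' 'x *' 'z *' 'y *' 'z)) => A.
split=> [regA v | idA x y z]; first exact: regA.
exact: idA (valuation3 x y z).
Qed.

(* As for hypersubstitutions, false selects the left-sided and true the
   right-sided version. *)
Definition zero_bands (b : bool) : set algebra :=
  [set A : algebra | forall x y : A, x ** y = if b then y else x].

Definition sided_regular_bands (b : bool) : set algebra :=
  is_band `&`
  [set A : algebra | forall x y : A, x ** y = if b then y ** x ** y else x ** y ** x].

Lemma is_variety_zero_bands b : is_variety (zero_bands b).
Proof.
apply: (@is_variety_identity _ ('x *' 'y, if b then 'y else 'x)) => A.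
split=> [zeroA v | idA x y].
  by rewrite /= zeroA; case: b {zeroA}.
by have := idA (valuation3 x y y); case: b {idA}.
Qed.

Lemma is_variety_sided_regular_bands b : is_variety (sided_regular_bands b).
Proof.
apply: is_varietyI is_variety_band _.
apply: (@is_variety_identity _
  ('x *' 'y, if b then 'y *' 'x *' 'y else 'x *' 'y *' 'x)) => A.
split=> [regA v | idA x y].
  by rewrite /= regA; case: b {regA}.
by have := idA (valuation3 x y y); case: b {idA}.
Qed.

Lemma zero_bands_RegB b : zero_bands b `<=` RegB.
Proof.
move=> A zeroA; split; first split.
- by move=> x y z; rewrite !zeroA; case: b {zeroA}.
- by move=> x; rewrite zeroA; case: b {zeroA}.
- by move=> x y z; rewrite !zeroA; case: b {zeroA}.
Qed.

(** A left regular band absorbs a letter that has already occurred, so the inner [z] disappears; in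
    a right regular band a letter that recurs later is absorbed, and both sides become
    [x ** y ** z]. *)
Lemma sided_regular_bands_RegB b : sided_regular_bands b `<=` RegB.
Proof.
move=> A [[assocA idemA] regA]; split=> // x y z; case: b regA => regA.
  by rewrite -(assocA z x y) -regA -(regA x z) -(assocA x z) -(assocA x (z ** y)) -regA
     assocA.
by rewrite -regA.
Qed.

(** * Normal forms of binary terms over bands *)

(* The alternating product of n + 1 letters that starts with the letter b. *)
Fixpoint alternating (b : bool) (n : nat) : hypersubstitution :=
  if n is n'.+1 then Var b *' alternating (~~ b) n' else Var b.

(** This is equality in the free band on two generators. *)
Definition band_equiv (s t : hypersubstitution) : Prop :=
  forall (A : algebra) (v : bool -> A), is_band A -> eval v s = eval v t.

Definition reducible (s : hypersubstitution) : Prop :=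
  exists b n, (n < 3)%N /\ band_equiv s (alternating b n).

Lemma reducible_equiv s t : band_equiv s t -> reducible t -> reducible s.
Proof.
move=> st [b [n [n3 tbn]]]; exists b, n; split=> // A v bandA.
by rewrite st // tbn.
Qed.

(** A prepended letter is absorbed if it equals the first letter, and otherwise lengthens the word;
    four letters [abab] collapse to [ab] by idempotence. *)
Lemma reducible_Var_alternating a b n :
  (n < 3)%N -> reducible (Var a *' alternating b n).
Proof.
move=> n3; have [->|/negPf ab] := eqVneq a b.
  exists b, n; split=> // A v [assocA idemA].
  by case: n n3 => [|n] _ /=; rewrite ?assocA idemA.
have -> : b = ~~ a by case: a b ab => [] [].
move: n3; rewrite ltnS leq_eqVlt => /orP[/eqP ->|n2].
  exists a, 1%N; split=> // A v [assocA idemA] /=.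
  by rewrite negbK !assocA -(assocA (v a ** _)) idemA.
by exists a, n.+1.
Qed.

(** Reassociating to the right prepends the letters of [s] to [t] one by one, whence the induction
    on [s] for all [t]. *)
Lemma reducible_App s t : reducible t -> reducible (s *' t).
Proof.
elim: s t => [a|s1 IH1 s2 IH2] t redt.
  have [b [n [n3 tbn]]] := redt.
  apply: reducible_equiv (reducible_Var_alternating a b n3) => A v bandA.
  by rewrite /= tbn.
apply: reducible_equiv (IH1 _ (IH2 _ redt)) => A v [assocA _].
by rewrite /= assocA.
Qed.

Lemma reducible_hypersubstitution s : reducible s.
Proof.
elim: s => [b|s1 _ s2]; last exact: reducible_App.
by exists b, 0%N.
Qed.

(** * The derived varieties of regular bands *)

Lemma derived_id s (A : algebra) :
  (forall x y : A, eval (fun b : bool => if b then y else x) s = x ** y) ->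
  derived s A = A.
Proof.
case: A => T o sE; congr Algebra.
by apply/funext => x; apply/funext => y; exact: sE.
Qed.

Lemma derived_equiv s t (A : algebra) :
  is_band A -> band_equiv s t -> derived s A = derived t A.
Proof.
move=> bandA st; congr Algebra.
by apply/funext => x; apply/funext => y; exact: st.
Qed.

Lemma derived_variety_equiv s t :
  band_equiv s t -> derived_variety RegB s = derived_variety RegB t.
Proof.
move=> st; congr generated_variety; apply/seteqP; split => _ [A RegA <-].
  by exists A => //; rewrite (derived_equiv RegA.1 st).
by exists A => //; rewrite (derived_equiv RegA.1 st).
Qed.

(** The derived algebras already make up all of [V], so generating a variety adds nothing. *)
Lemma derived_variety_image s (V : set algebra) :
  is_variety V -> (forall A, RegB A -> V (derived s A)) ->
  (forall A, V A -> exists2 B, RegB B & derived s B = A) ->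
  derived_variety RegB s = V.
Proof.
move=> varV RegV VReg; rewrite -[RHS](generated_variety_id varV).
congr generated_variety; apply/seteqP; split => [_ [A RegA <-]|A VA].
  exact: RegV.
exact: VReg.
Qed.

Lemma derived_variety_letter b :
  derived_variety RegB (alternating b 0) = zero_bands b.
Proof.
apply: derived_variety_image => [|//|A zeroA].
  exact: is_variety_zero_bands.
exists A; first exact: zero_bands_RegB zeroA.
by apply: derived_id => x y; rewrite zeroA.
Qed.

(** For [b = true] this is the opposite band, and the regularity identity is its own mirror image up
    to renaming. *)
Lemma RegB_derived_alternating b A :
  RegB A -> RegB (derived (alternating b 1) A).
Proof.
move=> [[assocA idemA] regA]; case: b; (split; first split).
- by move=> x y z; rewrite /= assocA.
- by move=> x; exact: idemA.
- by move=> x y z; rewrite /= !assocA regA.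
- by move=> x y z; exact: assocA.
- by move=> x; exact: idemA.
- by move=> x y z; exact: regA.
Qed.

Lemma derived_variety_pair b :
  derived_variety RegB (alternating b 1) = RegB.
Proof.
apply: derived_variety_image => [|A|A RegA]; first exact: is_variety_RegB.
  exact: RegB_derived_alternating.
(* Deriving twice by the same word [xy] or [yx] returns [A]. *)
exists (derived (alternating b 1) A); first exact: RegB_derived_alternating.
by case: A {RegA} => T o; case: b.
Qed.

(** Only associativity needs regularity: for [b = false] the two bracketings are [xyzyx] and
    [xyxzxyx], and regularity deletes the two inner [x] not shared by both. The other side is the
    mirror image. *)
Lemma sided_regular_bands_derived b A :
  RegB A -> sided_regular_bands b (derived (alternating b 2) A).
Proof.
move=> [[assocA idemA] regA]; case: b; (split; first split).
- move=> x y z /=; rewrite !assocA -regA.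
  by rewrite -(assocA z y x) -regA !assocA.
- by move=> x; rewrite /= !idemA.
- by move=> x y; rewrite /= -!assocA (assocA x y) idemA.
- move=> x y z /=; rewrite !assocA -regA.
  by rewrite -(assocA x y z) -regA !assocA.
- by move=> x; rewrite /= !idemA.
- by move=> x y; rewrite /= (assocA x x) !idemA.
Qed.

Lemma derived_variety_triple b :
  derived_variety RegB (alternating b 2) = sided_regular_bands b.
Proof.
apply: derived_variety_image => [|A|A regA].
- exact: is_variety_sided_regular_bands.
- exact: sided_regular_bands_derived.
(* One-sided regularity makes the triple product equal to [x ** y], so [A] is its own derived
   algebra. *)
exists A; first exact: sided_regular_bands_RegB regA.
case: regA => [[assocA _] regA]; apply: derived_id => x y.
by rewrite regA; case: b {regA}; rewrite /= assocA.
Qed.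

(** * Separation by two-element bands *)

Definition bool_zero_band (b : bool) : algebra :=
  Algebra (fun x y : bool => if b then y else x).

Definition bool_semilattice : algebra := Algebra andb.

Lemma zero_bands_bool b c : zero_bands b (bool_zero_band c) <-> b = c.
Proof.
split=> [/(_ false true)|->]; first by case: b c => [] [].
by move=> x y.
Qed.

Lemma sided_regular_bands_bool b c :
  sided_regular_bands b (bool_zero_band c) <-> b = c.
Proof.
split=> [[_ /(_ false true)]|->]; first by case: b c => [] [].
by split; [split | ]; case: c => // x y.
Qed.

Lemma zero_bands_semilattice b : ~ zero_bands b bool_semilattice.
Proof. by case: b => [/(_ false true)|/(_ true false)]. Qed.

Lemma sided_regular_bands_semilattice b :
  sided_regular_bands b bool_semilattice.
Proof.
by split; [split; [exact: andbA | exact: andbb] | case: b => [] [] []].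
Qed.

Lemma zero_bands_inj : injective zero_bands.
Proof. by move=> b c bc; apply/zero_bands_bool; rewrite bc => x y. Qed.

Lemma sided_regular_bands_inj : injective sided_regular_bands.
Proof.
move=> b c bc; apply/sided_regular_bands_bool; rewrite bc.
exact/sided_regular_bands_bool.
Qed.

Lemma zero_sided_regular_bands_neq b c :
  zero_bands b <> sided_regular_bands c.
Proof.
move=> bc; apply: (@zero_bands_semilattice b); rewrite bc.
exact: sided_regular_bands_semilattice.
Qed.

Lemma zero_bands_neq_RegB b : zero_bands b <> RegB.
Proof.
move=> bReg; suff /zero_bands_bool : zero_bands b (bool_zero_band (~~ b)).
  by case: b {bReg}.
by rewrite bReg; apply: (@zero_bands_RegB (~~ b)).
Qed.

(** The zero band of the opposite side is regular but violates the one-sided identity. *)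
Lemma sided_regular_bands_neq_RegB b : sided_regular_bands b <> RegB.
Proof.
move=> bReg.
suff /sided_regular_bands_bool :
    sided_regular_bands b (bool_zero_band (~~ b)) by case: b {bReg}.
by rewrite bReg; apply: (@zero_bands_RegB (~~ b)).
Qed.

(** * Enumeration and count *)

(** The parity of the index carries the side; only indices below 4 matter. *)
Definition proper_derived (i : nat) : set algebra :=
  if (i < 2)%N then zero_bands (odd i) else sided_regular_bands (odd i).

Lemma proper_derived_subvarieties_RegB :
  proper_derived_subvarieties RegB = proper_derived @` `I_4.
Proof.
apply/seteqP; split => [W [[s ->] [sNReg _]]|_ [i _ <-]].
  have [b [n [n3 sbn]]] := reducible_hypersubstitution s.
  move: sNReg; rewrite (derived_variety_equiv sbn).
  case: n n3 {sbn} => [|[|[|//]]] _.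
  - by rewrite derived_variety_letter => _; exists b; case: b.
  (* The words [xy] and [yx] give [RegB] itself, against properness. *)
  - by rewrite derived_variety_pair.
  - by rewrite derived_variety_triple => _; exists (2 + b)%N; case: b.
rewrite /proper_derived; case: ifP => _; (split; last split).
- by exists (alternating (odd i) 0); rewrite derived_variety_letter.
- exact: zero_bands_neq_RegB.
- exact: zero_bands_RegB.
- by exists (alternating (odd i) 2); rewrite derived_variety_triple.
- exact: sided_regular_bands_neq_RegB.
- exact: sided_regular_bands_RegB.
Qed.

Lemma proper_derived_inj : {in `I_4 &, injective proper_derived}.
Proof.
move=> i j /set_mem/= i4 /set_mem/= j4; rewrite /proper_derived.
case: ifP => i2; case: ifP => j2.
(* Equal sides mean equal parities, and parity is injective on 0, 1 and, in the last case, on 2,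
   3. *)
- by move=> /zero_bands_inj; case: i j i2 j2 {i4 j4} => [|[|//]] [|[|//]].
- by move=> /zero_sided_regular_bands_neq.
- by move=> /esym/zero_sided_regular_bands_neq.
- move=> /sided_regular_bands_inj.
  by case: i j i4 j4 i2 j2 => [|[|[|[|//]]]] [|[|[|[|//]]]].
Qed.

Theorem theorem4p8 : has_dim RegB 4.
Proof.
rewrite /has_dim proper_derived_subvarieties_RegB.
exact: inj_card_eq proper_derived_inj.
Qed.
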